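(* Suppose $G_1$ and $G_2$ are GFERF hyperbolic groups. Then the free product $G = G_1 * G_2$ is also a GFERF hyperbolic group.
   Context: Let $G$ be a word (Gromov) hyperbolic group with a finite symmetrized generating set $\mathcal{A}$ and Cayley graph $\Gamma(G,\mathcal{A})$. A subset $Q \subseteq G$ is quasiconvex if there exists $\eta \ge 0$ such that for any $u,v \in Q$, every geodesic segment in $\Gamma(G,\mathcal{A})$ connecting $u$ and $v$ lies in the closed $\eta$-neighborhood of $Q$; for hyperbolic groups this does not depend on the choice of the finite generating set. The profinite topology on $G$ has as basic open sets the cosets of normal finite index subgroups; a subgroup is closed in it if and only if it is an intersection of finite index subgroups of $G$. A hyperbolic group is GFERF if each of its quasiconvex subgroups is closed in the profinite topology. *)

(* Defs.v *)
(* Groups are (possibly infinite) [groupType]s; subsets and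
   subgroups are Prop-valued [set]s, so no decidability is imposed on them. *)
From mathcomp Require Import all_boot boolp classical_sets.

Set Implicit Arguments.
Unset Strict Implicit.
Unset Printing Implicit Defensive.

Local Open Scope classical_set_scope.
Local Open Scope group_scope.

Definition symmetric_generating (G : groupType) (A : seq G) : Prop :=
  (forall a, a \in A -> a^-1 \in A) /\
  (forall g, exists2 w : seq G, {subset w <= A} & g = \prod_(a <- w) a).

(* The Cayley graph is used combinatorially: its vertices are the elements of
   the group, and an edge path starting at x is given, as in path.v, by the
   sequence p of its vertices other than x.  Any point on an edge is within 1/2
   of a vertex, so working with vertices only changes the additive constants
   delta and eta below. *)
Definition cayley (G : groupType) (A : seq G) : rel G :=
  [rel x y | x^-1 * y \in A].

Definition edge_path (G : groupType) (A : seq G) (x y : G) (p : seq G) : Prop :=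
  path (cayley A) x p /\ last x p = y.

Definition geodesic (G : groupType) (A : seq G) (x y : G) (p : seq G) : Prop :=
  edge_path A x y p /\ forall q, edge_path A x y q -> size p <= size q.

(* d_A(x, y) <= n for the word metric d_A *)
Definition word_dist_le (G : groupType) (A : seq G) (n : nat) (x y : G) : Prop :=
  exists2 p, edge_path A x y p & size p <= n.

(* Geodesic triangles are uniformly slim.  Stating the condition for one side is
   enough, as the sides p, q, r of a triangle can be permuted cyclically. *)
Definition slim_triangles (G : groupType) (A : seq G) (delta : nat) : Prop :=
  forall (x y z : G) (p q r : seq G),
    geodesic A x y p -> geodesic A y z q -> geodesic A z x r ->
  forall u, u \in x :: p ->
  exists2 v, (v \in y :: q) || (v \in z :: r) & word_dist_le A delta u v.

Definition hyperbolic_group (G : groupType) : Prop :=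
  exists A : seq G,
    symmetric_generating A /\ exists delta, slim_triangles A delta.

Definition quasiconvex_wrt (G : groupType) (A : seq G) (Q : set G) : Prop :=
  exists eta : nat, forall (u v : G) (p : seq G),
    Q u -> Q v -> geodesic A u v p ->
  forall x, x \in u :: p -> exists2 y, Q y & word_dist_le A eta x y.

(* In a hyperbolic group the choice of the finite generating set is immaterial. *)
Definition quasiconvex (G : groupType) (Q : set G) : Prop :=
  exists2 A : seq G, symmetric_generating A & quasiconvex_wrt A Q.

Definition is_subgroup (G : groupType) (H : set G) : Prop :=
  [/\ H 1, (forall x y, H x -> H y -> H (x * y)) & (forall x, H x -> H x^-1)].

Definition is_normal (G : groupType) (H : set G) : Prop :=
  forall x g, H x -> H (x ^ g).

Definition finite_index (G : groupType) (H : set G) : Prop :=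
  exists s : seq G, forall g, exists2 t, t \in s & H (t^-1 * g).

Definition profinite_open (G : groupType) (U : set G) : Prop :=
  forall g, U g -> exists N : set G,
    [/\ is_subgroup N, is_normal N, finite_index N &
        [set g * n | n in N] `<=` U].

Definition profinite_closed (G : groupType) (C : set G) : Prop :=
  profinite_open (~` C).

Definition GFERF (G : groupType) : Prop :=
  forall H : set G, is_subgroup H -> quasiconvex H -> profinite_closed H.

(* Universal property of the coproduct G1 -i1-> G <-i2- G2 in groups. *)
Definition is_free_product (G1 G2 G : groupType)
    (i1 : {multiplicative G1 -> G}) (i2 : {multiplicative G2 -> G}) : Prop :=
  forall (K : groupType)
    (f1 : {multiplicative G1 -> K}) (f2 : {multiplicative G2 -> K}),
  exists f : {multiplicative G -> K},
    [/\ f \o i1 =1 f1, f \o i2 =1 f2 &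
        forall f' : {multiplicative G -> K},
          f' \o i1 =1 f1 -> f' \o i2 =1 f2 -> f' =1 f].

(* Main.v *)
From HB Require Import structures.
Require Import Defs.
From mathcomp Require Import all_boot perm boolp classical_sets zify.

Set Implicit Arguments.
Unset Strict Implicit.
Unset Printing Implicit Defensive.

Local Open Scope classical_set_scope.
Local Open Scope group_scope.

(** Write [G = G1 * G2]. Both hyperbolicity and separability rest on the
    projection [pi : G -> G1] sending a normal form to its first syllable when
    that syllable lies in [G1], and to [1] otherwise. It is obtained from the
    universal property alone ([projection_exists]); it commutes with left
    multiplication by [G1], and right multiplication by an element of a factor
    changes [pi w] only if [w] already lies in [G1].

    Hyperbolicity ([free_product_hyperbolic]). For the union of generating sets
    of the factors, [pi] collapses every edge that does not lie in [G1], so a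
    geodesic that leaves [G1] could only come back to the same vertex. Hence a
    geodesic meets [G1] in a geodesic of [G1] between the projections of its
    ends ([geodesic_in_factor]). Given a vertex [u] on a side of a triangle,
    some edge of that side at [u] lies in a coset of a factor; after a
    translation to this factor, the triangle projects to a geodesic triangle of
    the factor, which is slim.

    Separability. Let [H] be quasiconvex and [g] outside [H]. The subgroup [H]
    is finitely generated ([quasiconvex_finitely_generated]). Suppose that for
    every [x] the stabilizers of the coset [H x] in [G1] and in [G2] are closed.
    Then Burns' argument applies ([closed_of_stabilizers_closed]): write [g] and
    the generators of [H] as products of syllables, and consider the finitely
    many points of [H\G] visited by their prefixes. As stabilizers are closed,
    each factor acts on some finite set in which these points remain distinct
    and are permuted as in [H\G] ([finite_local_action]). Identifying the two
    copies of the points and extending the actions trivially makes both factors,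
    hence [G], act on one finite set, where [H] fixes the base point and [g]
    moves it. The kernel of this action separates [g] from [H].

    It remains to see that the stabilizer [K] of [H x] in [G1] is quasiconvex in
    [G1] ([coset_stabilizer_quasiconvex]). The quasiconvexity of [H] is given
    for an arbitrary generating set of [G], but even then [pi] moves along an
    edge only if the edge is close to its projection ([proj_step]). So the
    projection of a geodesic joining two points of [K x^-1] stays close to this
    geodesic, hence is a quasigeodesic of [G1] near [K]. By the stability of
    geodesics ([geodesic_near_quasigeodesic]), geodesics of [G1] between points
    of [K] are near [K] as well. *)

(** * Free products and their projections *)

Lemma mulf1 (G K : groupType) (f : {multiplicative G -> K}) : f 1 = 1.
Proof. by apply: (@mulgI _ (f 1)); rewrite -gmulfM !mulg1. Qed.

Lemma mulfV (G K : groupType) (f : {multiplicative G -> K}) x :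
  f x^-1 = (f x)^-1.
Proof. by apply: (@mulgI _ (f x)); rewrite -gmulfM !mulgV mulf1. Qed.

Lemma mulf_prod (G K : groupType) (f : {multiplicative G -> K}) s :
  f (\prod_(a <- s) a) = \prod_(b <- map f s) b.
Proof.
by elim: s => [|a s IH]; rewrite ?big_nil ?mulf1 //= !big_cons gmulfM IH.
Qed.

Lemma free_product_sym (G1 G2 G : groupType)
    (i1 : {multiplicative G1 -> G}) (i2 : {multiplicative G2 -> G}) :
  is_free_product i1 i2 -> is_free_product i2 i1.
Proof.
move=> U K f2 f1; have [f [e1 e2 u]] := U K f1 f2.
by exists f; split=> // f' *; apply: u.
Qed.

Definition multiplicative_of (G K : groupType) (f : G -> K)
    (fM : {morph f : x y / x * y}) : {multiplicative G -> K} :=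
  HB.pack f (isMultiplicative.Build G K f fM).

Section Wreath.
Variables G K : groupType.

(** The unrestricted wreath product of [K] by the regular right action of [G].
    A crossed homomorphism from [G] to the functions [G -> K] is a homomorphism
    [G -> wreath G K] over [G], so the universal property of [G] yields crossed
    homomorphisms with prescribed values on the factors. *)
Record wreath : Type := Wreath { wfun : G -> K; wtop : G }.

HB.instance Definition _ := gen_eqMixin wreath.
HB.instance Definition _ := gen_choiceMixin wreath.

Definition wmul (s t : wreath) :=
  Wreath (fun w => wfun s w * wfun t (w * wtop s)) (wtop s * wtop t).
Definition wone := Wreath (fun=> 1) 1.
Definition winv (s : wreath) :=
  Wreath (fun w => (wfun s (w * (wtop s)^-1))^-1) (wtop s)^-1.

Lemma wreathP (s t : wreath) :
  (forall w, wfun s w = wfun t w) -> wtop s = wtop t -> s = t.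
Proof. by case: s t => [f g] [f' g'] /= /funext -> ->. Qed.

Lemma wmulA : associative wmul.
Proof. by move=> s t u; apply: wreathP => [w|] /=; rewrite !mulgA. Qed.
Lemma wmul1 : left_id wone wmul.
Proof. by move=> s; apply: wreathP => [w|] /=; rewrite ?mulg1 mul1g. Qed.
Lemma wmul1r : right_id wone wmul.
Proof. by move=> s; apply: wreathP => [w|] /=; rewrite mulg1. Qed.
Lemma wmulV : left_inverse wone winv wmul.
Proof. by move=> s; apply: wreathP => [w|] /=; rewrite mulVg. Qed.
Lemma wmulVr : right_inverse wone winv wmul.
Proof. by move=> s; apply: wreathP => [w|] /=; rewrite ?mulgK mulgV. Qed.

HB.instance Definition _ :=
  isGroup.Build wreath wmulA wmul1 wmul1r wmulV wmulVr.

Lemma wfunM (s t : wreath) w :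
  wfun (s * t) w = wfun s w * wfun t (w * wtop s).
Proof. by []. Qed.
Lemma wtopM (s t : wreath) : wtop (s * t) = wtop s * wtop t.
Proof. by []. Qed.
End Wreath.

Section FreeProduct.
Variables (G1 G2 G : groupType).
Variables (i1 : {multiplicative G1 -> G}) (i2 : {multiplicative G2 -> G}).
Hypothesis U : is_free_product i1 i2.

(** If [P] is invariant under the factors, the coboundary of its indicator
    function (valued in a group of order two) is a crossed homomorphism trivial
    on both factors.  By uniqueness it is trivial on [G], so [P] is constant. *)
Lemma free_product_ind (P : G -> Prop) :
  P 1 -> (forall w a, P w -> P (w * i1 a)) ->
  (forall w b, P w -> P (w * i2 b)) -> forall w, P w.
Proof.
move=> P1 Pi1 Pi2.
pose S w := `[< P w >].
have S1 w a : S (w * i1 a) = S w.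
  apply/asboolP/asboolP=> [|/Pi1 //]; rewrite -{2}[w](mulgK (i1 a)) -mulfV.
  exact: Pi1.
have S2 w a : S (w * i2 a) = S w.
  apply/asboolP/asboolP=> [|/Pi2 //]; rewrite -{2}[w](mulgK (i2 a)) -mulfV.
  exact: Pi2.
pose flip (b : bool) : {perm bool} := if b then tperm true false else 1.
pose h (g : G) : wreath G {perm bool} := Wreath (fun=> 1) g.
pose h' (g : G) := Wreath (fun w => flip (S w) * (flip (S (w * g)))^-1) g.
have hM : {morph h : x y / x * y}.
  by move=> x y; apply: wreathP => [w|] //=; rewrite mulg1.
have h'M : {morph h' : x y / x * y}.
  by move=> x y; apply: wreathP => [w|] //=; rewrite !mulgA mulgVK.
have [f [_ _ fU]] := U (multiplicative_of hM \o i1)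
  (multiplicative_of hM \o i2).
have e : multiplicative_of hM =1 multiplicative_of h'M.
  move=> g; rewrite (fU (multiplicative_of hM)) //.
  by rewrite (fU (multiplicative_of h'M)) // => a; apply: wreathP=> //= w;
     rewrite ?S1 ?S2 mulgV.
move=> w; have /(congr1 (fun t => wfun t 1)) /= := e w.
rewrite mul1g /flip; have -> : S 1 by apply/asboolP.
rewrite /S; case: (asboolP (P w)) => // _; rewrite invg1 mulg1.
by move/(congr1 (fun s : {perm bool} => s true)); rewrite tpermL perm1.
Qed.

(** This characterizes the map sending a normal form to its first syllable if
    that syllable is in [G1], and to [1] if not. *)
Definition is_projection (pi : G -> G1) : Prop :=
  [/\ forall a w, pi (i1 a * w) = a * pi w,
      pi 1 = 1,
      forall w a, ~ (exists c, w = i1 c) -> pi (w * i1 a) = pi w &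
      forall w b, pi (w * i2 b) = pi w].

(** The increments of [pi] under right multiplication form a crossed
    homomorphism: [i1 a] contributes [a] at the points of [i1 G1] and [1]
    elsewhere, while [i2 b] contributes [1] everywhere.  Both prescriptions are
    homomorphisms into the wreath product because right multiplication by
    [i1 a] preserves [i1 G1]; hence they extend to [G], and [pi w] is the
    increment from [1] to [w]. *)
Lemma projection_exists : exists pi, is_projection pi.
Proof.
pose C w := `[< exists c, w = i1 c >].
have Cr w a : C (w * i1 a) = C w.
  apply/asboolP/asboolP=> -[c e]; last by exists (c * a); rewrite e gmulfM.
  by exists (c * a^-1); rewrite gmulfM mulfV -e mulgK.
have Cl w a : C (i1 a * w) = C w.
  apply/asboolP/asboolP=> -[c e]; last by exists (a * c); rewrite e gmulfM.
  by exists (a^-1 * c); rewrite gmulfM mulfV -e mulKg.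
pose h1 a : wreath G G1 := Wreath (fun w => if C w then a else 1) (i1 a).
pose h2 b : wreath G G1 := Wreath (fun=> 1) (i2 b).
have h1M : {morph h1 : x y / x * y}.
  by move=> x y; apply: wreathP => [w|] /=; rewrite ?Cr ?gmulfM //;
     case: ifP; rewrite ?mulg1.
have h2M : {morph h2 : x y / x * y}.
  by move=> x y; apply: wreathP => [w|] /=; rewrite ?mulg1 ?gmulfM.
have [f [f1 f2 _]] := U (multiplicative_of h1M) (multiplicative_of h2M).
have ft : forall w, wtop (f w) = w.
  apply: free_product_ind => [|w a e|w b e]; first by rewrite mulf1.
    by rewrite gmulfM wtopM e; have /= -> := f1 a.
  by rewrite gmulfM wtopM e; have /= -> := f2 b.
pose pi w := wfun (f w) 1.
have p1 w a : pi (w * i1 a) = pi w * (if C w then a else 1).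
  by rewrite /pi gmulfM wfunM mul1g ft; have /= -> := f1 a.
have p2 w b : pi (w * i2 b) = pi w.
  by rewrite /pi gmulfM wfunM mul1g ft; have /= -> := f2 b; rewrite mulg1.
have C1 : C 1 by apply/asboolP; exists 1; rewrite mulf1.
have pi1 : pi 1 = 1 by rewrite /pi mulf1.
exists pi; split=> //.
  move=> a; apply: (free_product_ind (P :=
    fun w => pi (i1 a * w) = a * pi w)) => [|w b e|w b e].
  - by rewrite mulg1 pi1 mulg1 -[i1 a]mul1g p1 C1 pi1 mul1g.
  - by rewrite mulgA !p1 Cl e mulgA.
  - by rewrite mulgA !p2 e.
by move=> w a Cw; rewrite p1 /C; case: asboolP => // _; rewrite mulg1.
Qed.
End FreeProduct.

(** * Word metrics and slim triangles *)

Section WordMetric.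
Variables (G : groupType) (A : seq G).
Local Notation wd := (word_dist_le A).

Lemma wd_refl n x : wd n x x.
Proof. by exists [::]. Qed.

Lemma wd_leq m n x y : m <= n -> wd m x y -> wd n x y.
Proof. by move=> mn [p ep pm]; exists p => //; apply: leq_trans mn. Qed.

Lemma wd_trans m n y x z : wd m x y -> wd n y z -> wd (m + n) x z.
Proof.
move=> [p [pp lp] sp] [q [pq lq] sq]; exists (p ++ q).
  by split; rewrite ?cat_path ?last_cat lp ?pp.
by rewrite size_cat leq_add.
Qed.

Lemma wd_edge x y : x^-1 * y \in A -> wd 1 x y.
Proof. by move=> e; exists [:: y] => //; split=> //=; rewrite andbT. Qed.

Lemma edge_path_wd x y p : edge_path A x y p -> wd (size p) x y.
Proof. by exists p. Qed.

Lemma cayley_mul g x y : cayley A (g * x) (g * y) = cayley A x y.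
Proof. by rewrite /cayley /= invgM -mulgA mulKg. Qed.

Lemma edge_path_mul g x y p :
  edge_path A x y p -> edge_path A (g * x) (g * y) [seq g * z | z <- p].
Proof.
move=> [pp <-]; split; last by rewrite last_map.
elim: p x pp => //= a p IH x /andP[e /IH ->].
by rewrite cayley_mul e.
Qed.

Lemma wd_mul g n x y : wd n (g * x) (g * y) <-> wd n x y.
Proof.
have H h u v : wd n u v -> wd n (h * u) (h * v).
  move=> [p /(edge_path_mul h) ep sp].
  by exists [seq h * z | z <- p]; rewrite ?size_map.
by split=> [/(H g^-1)|/H //]; rewrite !mulKg.
Qed.

Lemma wd_one n x y : wd n x y <-> wd n 1 (x^-1 * y).
Proof. by rewrite -(wd_mul x^-1) mulVg. Qed.

Lemma geodesic_mul g x y p :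
  geodesic A x y p -> geodesic A (g * x) (g * y) [seq g * z | z <- p].
Proof.
move=> [/(edge_path_mul g) ep mp]; split=> // q /(edge_path_mul g^-1).
by rewrite !mulKg => /mp; rewrite !size_map.
Qed.

Lemma geodesic_leq x y p n : geodesic A x y p -> wd n x y -> size p <= n.
Proof. by move=> [_ mp] [q /mp le]; apply: leq_trans. Qed.

Lemma geodesic_cat x y p q : geodesic A x y (p ++ q) ->
  geodesic A x (last x p) p /\ geodesic A (last x p) y q.
Proof.
move=> [[]]; rewrite cat_path last_cat => /andP[pp pq] lq mp.
split; split=> //.
  move=> r [pr lr]; have := mp (r ++ q); rewrite !size_cat leq_add2r; apply.
  by split; rewrite ?cat_path ?last_cat lr ?pr.
move=> r [pr lr]; have := mp (p ++ r); rewrite !size_cat leq_add2l; apply.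
by split; rewrite ?cat_path ?last_cat ?pp.
Qed.

Lemma geodesic_infix x y p s a q t :
  geodesic A x y p -> x :: p = s ++ (a :: q) ++ t -> geodesic A a (last a q) q.
Proof.
case: s => [|b s] gp /= [? e]; subst.
  by have [] := geodesic_cat gp.
have : geodesic A b y (rcons s a ++ q ++ t) by rewrite cat_rcons.
move=> /geodesic_cat [_]; rewrite last_rcons => /geodesic_cat [] //.
Qed.

Lemma geodesic_uniq x y p : geodesic A x y p -> uniq (x :: p).
Proof.
elim: p x => // a p IH x gp; have [_ /IH /= u] := geodesic_cat (p := [:: a]) gp.
rewrite /= u andbT; apply/negP => xin.
move: gp; case: (a :: p) / (splitPr xin) => p1 p2 [[pp lp] mp].
have: edge_path A x y p2.
  by move: pp lp; rewrite cat_path last_cat /= => /and3P[_ _ ?] ?.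
by move/mp; rewrite size_cat /=; lia.
Qed.

Lemma geodesic_nth x y p i j : geodesic A x y p -> i <= j <= size p ->
  wd (j - i) (nth x (x :: p) i) (nth x (x :: p) j) /\
  forall m, wd m (nth x (x :: p) i) (nth x (x :: p) j) -> j - i <= m.
Proof.
move=> gp /andP[ij jp].
have lE k : k <= size p -> last x (take k p) = nth x (x :: p) k.
  move=> kp; rewrite (last_nth x) size_takel //.
  by rewrite -[x :: take k p]/(take k.+1 (x :: p)) nth_take.
move: gp; rewrite -(cat_take_drop j p) => /geodesic_cat [].
rewrite !lE // => gp _; move: gp.
rewrite -{1}(cat_take_drop i (take j p)) => /geodesic_cat [_].
rewrite take_takel // lE ?(leq_trans ij) // => gp.
have sz : size (drop i (take j p)) = j - i by rewrite size_drop size_takel.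
rewrite cat_take_drop; split=> [|m /(geodesic_leq gp)]; last by rewrite sz.
by rewrite -sz; apply: edge_path_wd; case: gp.
Qed.

Hypothesis Asym : forall a, a \in A -> a^-1 \in A.

Lemma cayley_sym x y : cayley A x y -> cayley A y x.
Proof. by move/Asym; rewrite /cayley /= invgM invgK. Qed.

Lemma wd_sym n x y : wd n x y -> wd n y x.
Proof.
move=> [p [pp lp] pn]; apply: (wd_leq pn) => {pn n}.
elim: p x pp lp => [x _ <-|a p IH x /= /andP[e pp] lp]; first exact: wd_refl.
rewrite -addn1; apply: wd_trans (IH _ pp lp) _.
by apply: wd_edge; apply: cayley_sym e.
Qed.

(** The vertex [v] lies on some geodesic from [x] to [y]: the distances from [v]
    to the ends add up to the distance of the ends. *)
Definition between (x v y : G) : Prop := exists m n,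
  [/\ wd m x v, wd n v y & forall k, wd k x y -> m + n <= k].

Lemma between_sym x v y : between x v y -> between y v x.
Proof.
move=> [m [n [xv vy min]]]; exists n, m; split; try exact: wd_sym.
by move=> k /wd_sym/min; rewrite addnC.
Qed.

Lemma geodesic_between x y p v : geodesic A x y p -> v \in x :: p ->
  between x v y.
Proof.
move=> gp /splitPl vp; case: vp gp => p1 p2 l1 gp.
have [] := geodesic_cat gp; rewrite l1 => -[e1 _] [e2 _].
exists (size p1), (size p2); split; try exact: edge_path_wd.
by move=> k /(geodesic_leq gp); rewrite size_cat.
Qed.

Lemma between_geodesic x v y :
  between x v y -> exists2 p, geodesic A x y p & v \in x :: p.
Proof.
move=> [m [n [[p [pp lp] pm] [q [pq lq] qn] min]]]; exists (p ++ q).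
  split; first by split; rewrite ?cat_path ?last_cat lp ?pp.
  move=> r /edge_path_wd /min; rewrite size_cat; lia.
by rewrite -cat_cons mem_cat -lp mem_last.
Qed.

Lemma between_wd x v y n : between x v y -> wd n x y -> wd n x v /\ wd n v y.
Proof.
move=> [k [l [xv vy min]]] /min le.
by split; [apply: wd_leq xv | apply: wd_leq vy]; lia.
Qed.

Hypothesis Agen : forall g, exists2 w : seq G,
  {subset w <= A} & g = \prod_(a <- w) a.

Lemma wd_exists x y : exists n, wd n x y.
Proof.
have [w wA e] := Agen (x^-1 * y).
have {}e : y = x * \prod_(a <- w) a by rewrite -e mulVKg.
exists (size w); rewrite {}e {y}.
elim: w x wA => [|a w IH] x wA; first by rewrite big_nil mulg1; apply: wd_refl.
rewrite big_cons mulgA -[size _]add1n; apply: (@wd_trans _ _ (x * a)).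
  by apply: wd_edge; rewrite mulKg wA ?mem_head.
by apply: IH => // b bw; apply: wA; rewrite in_cons bw orbT.
Qed.

Lemma geodesic_exists x y : exists p, geodesic A x y p.
Proof.
have [n nP] := wd_exists x y.
have ex : exists n, `[< wd n x y >] by exists n; apply/asboolP.
case: (ex_minnP ex) => m /asboolP[p ep pm] min; exists p; split=> // q eq.
by apply: leq_trans pm (min _ _); apply/asboolP/edge_path_wd.
Qed.

Lemma wd_bound (s : seq G) : exists M, forall x, x \in s -> wd M 1 x.
Proof.
elim: s => [|a s [M MP]]; first by exists 0.
have [n nP] := wd_exists 1 a; exists (n + M) => x.
rewrite in_cons => /orP[/eqP->|/MP].
  by apply: wd_leq nP; rewrite leq_addr.
by apply: wd_leq; rewrite leq_addl.
Qed.

Lemma ball_finite n : exists s : seq G, forall x, wd n 1 x -> x \in s.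
Proof.
elim: n => [|n [s sP]].
  by exists [:: 1] => x [[|//] [_ <-]] _; rewrite mem_head.
exists (s ++ [seq x * a | x <- s, a <- A]) => x [p [pp lp] sz].
case/lastP: p pp lp sz => [_ <- _|p a].
  by rewrite mem_cat sP //; apply: wd_refl.
rewrite rcons_path last_rcons size_rcons => /andP[pp e] <- sz.
rewrite mem_cat; apply/orP; right; apply/allpairsP.
exists (last 1 p, (last 1 p)^-1 * a); split=> //=; last by rewrite mulVKg.
by apply: sP; exists p.
Qed.
End WordMetric.

Section Slim.
Variables (G : groupType) (A : seq G) (delta : nat).
Hypothesis A_gen : symmetric_generating A.
Hypothesis slim : slim_triangles A delta.
Local Notation wd := (word_dist_le A).
Local Notation between := (between A).
Let Asym := A_gen.1.
Let Agen := A_gen.2.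

Lemma between_triangle x u y z : between x u y ->
  exists2 v, between x v z \/ between z v y & wd delta u v.
Proof.
move=> /between_geodesic [p gp up].
have [q gq] := geodesic_exists Agen y z.
have [r gr] := geodesic_exists Agen z x.
have [v /orP[vq|vr] uv] := slim gp gq gr up; exists v => //; [right|left].
  exact/(between_sym Asym)/(geodesic_between gq).
exact/(between_sym Asym)/(geodesic_between gr).
Qed.

Lemma between_quadrilateral x u y a b : between x u y ->
  exists2 v, [\/ between x v a, between a v b | between b v y] &
    wd (2 * delta) u v.
Proof.
move=> /(between_triangle a) [v [H|/(between_triangle b) [w H vw]] uv];
  rewrite mul2n -addnn.
  by exists v; [apply: Or31 | apply: wd_leq uv; lia].
by exists w; [case: H; [apply: Or32 | apply: Or33] | apply: wd_trans vw].
Qed.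

(** Cutting the chain at its middle point replaces [u] by a point at distance
    [delta] lying between the ends of one half; after [k] cuts the chain is a
    single step. *)
Lemma chain_near_geodesic M (f : nat -> G) k i n u :
  (forall j, i <= j < i + n -> wd M (f j) (f j.+1)) ->
  n <= 2 ^ k -> between (f i) u (f (i + n)) ->
  exists2 j, i <= j <= i + n & wd (k * delta + M) u (f j).
Proof.
elim: k i n u => [|k IH] i n u step nk ub.
  have [n0|n1] : n = 0%N \/ n = 1%N by lia.
    exists i; first lia.
    move: ub; rewrite n0 addn0 => /between_wd /(_ (wd_refl _ 0 _)) [_].
    by apply: wd_leq; lia.
  exists i; first lia.
  apply/(wd_sym Asym).
  by have [] := between_wd (n := M) ub; rewrite n1 addn1 //; apply: step; lia.
have [v H uv] := between_triangle (f (i + n./2)) ub.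
have [j jn vj] : exists2 j, i <= j <= i + n & wd (k * delta + M) v (f j).
  case: H => H.
    have [||//|j jn ?] := IH i n./2 v; first by move=> j jn; apply: step; lia.
      by move: nk; rewrite expnS; lia.
    by exists j => //; lia.
  have e : i + n = i + n./2 + (n - n./2) by lia.
  have [|||j jn ?] := IH (i + n./2) (n - n./2) v; last by exists j => //; lia.
  - by move=> j jn; apply: step; lia.
  - by move: nk; rewrite expnS; lia.
  - by rewrite -e.
by exists j => //; rewrite mulSn -addnA; apply: wd_trans vj.
Qed.
End Slim.

(** * Stability of geodesics *)

(** Since [n ^ 2 <= 2 ^ n] for [n >= 4], the logarithm of a linear function of
    [D] is at most the quotient [k] of [D - c.+1] by [q.+1], as soon as [k]
    exceeds a bound [t] depending on the coefficients. *)
Lemma log_lt_linear (q c a b : nat) :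
  exists R, forall D, R <= D -> q * up_log 2 (a * D + b) + c < D.
Proof.
have sq n : 4 <= n -> n * n <= 2 ^ n.
  elim: n => // n IH; rewrite leq_eqVlt => /orP[/eqP<- //|n4].
  have {}IH := IH n4; rewrite expnS mul2n -addnn.
  apply: leq_trans (leq_add IH IH).
  have : 3 * n <= n * n by rewrite leq_mul2r; lia.
  rewrite mulSn mulnS; lia.
pose t := (4 + a * q.+1 * 2 + (a * c.+1 + b))%N.
exists (c.+1 + q.+1 * t)%N => D RD.
pose k := ((D - c.+1) %/ q.+1)%N.
have kt : t <= k by rewrite leq_divRL // mulnC; lia.
have Dk : D <= c.+1 + q.+1 * k.+1.
  by have := ltn_ceil (D - c.+1) (ltn0Sn q); rewrite -/k mulnC; lia.
have kD : q * k + c < D.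
  have := leq_divM (D - c.+1) q.+1; rewrite -/k mulnC mulSn.
  by have : 0 < q.+1 * t by []; lia.
have k4 : 4 <= k by rewrite /t in kt; lia.
have le : a * D + b <= 2 ^ k.
  apply: leq_trans (sq k k4).
  have aD : a * D <= a * c.+1 + a * q.+1 * k.+1.
    by rewrite -mulnA -mulnDr leq_mul2l Dk orbT.
  have : t * k <= k * k by rewrite leq_mul2r kt orbT.
  have : a * c.+1 + b <= (a * c.+1 + b) * k by rewrite leq_pmulr //; lia.
  rewrite /t !mulnDl; move: aD; rewrite mulnS.
  have : a * q.+1 <= a * q.+1 * k by rewrite leq_pmulr //; lia.
  rewrite muln2 -addnn !mulnDl; lia.
have up : up_log 2 (a * D + b) <= k by apply: up_log_min.
by apply: leq_ltn_trans kD; rewrite leq_add2r leq_mul2l up orbT.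
Qed.

Section Morse.
Variables (G : groupType) (A : seq G) (delta : nat).
Hypothesis A_gen : symmetric_generating A.
Hypothesis slim : slim_triangles A delta.
Local Notation wd := (word_dist_le A).
Local Notation between := (between A).
Let Asym := A_gen.1.
Let Agen := A_gen.2.

(** The lower bound is stated without a distance function: every upper bound [m]
    of the distance controls the difference of the indices. *)
Definition quasigeodesic (M lambda eps N : nat) (f : nat -> G) : Prop :=
  (forall j, j < N -> wd M (f j) (f j.+1)) /\
  (forall i j m, i <= j <= N -> wd m (f i) (f j) -> j - i <= lambda * m + eps).

Lemma between_right x y z u : between x y z -> between y u z -> between x u z.
Proof.
move=> [m [n [xy yz xz]]] [k [l [yu uz yz']]].
exists (m + k)%N, l; split=> // [|p /xz]; first exact: wd_trans yu.
by have := yz' _ yz; lia.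
Qed.

(** This provides the corners of the quadrilateral cut out around the vertex
    farthest from a quasigeodesic in [geodesic_near_quasigeodesic]. *)
Lemma between_before E x v z : between x v z -> exists y,
  [/\ between x y z, between y v z, wd E y v &
      y = x \/ forall m, wd m y v -> E <= m].
Proof.
move=> /between_geodesic [p gp vp].
pose n := index v (x :: p).
have np : n <= size p by rewrite -ltnS -[(size p).+1]/(size (x :: p)) index_mem.
have nv : nth x (x :: p) n = v by apply: nth_index.
have [h1 h2] := geodesic_nth (i := n - E) (j := n) gp ltac:(lia).
have yp : nth x (x :: p) (n - E) \in x :: p by rewrite mem_nth //= ltnS; lia.
exists (nth x (x :: p) (n - E)); split.
- exact: geodesic_between gp yp.
- have [a1 a2] := geodesic_nth (i := n) (j := size p) gp ltac:(lia).
  have [b1 b2] := geodesic_nth (i := n - E) (j := size p) gp ltac:(lia).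
  have zE : nth x (x :: p) (size p) = z by rewrite -last_nth; case: gp => -[].
  rewrite zE nv in a1 b2 h1; exists (n - (n - E))%N, (size p - n)%N;
    split=> // k /b2; lia.
- by move: h1; rewrite nv; apply: wd_leq; lia.
have [le|lt] := leqP n E; first by left; have -> : n - E = 0%N by lia.
by right=> m; rewrite -nv => /h2; lia.
Qed.

(** Let [D] be the largest distance from a vertex of the geodesic to the
    quasigeodesic [f], attained at [v]. Points [y] and [z] slightly more than
    [D] away from [v] on both sides are within [D] of points [f i] and [f j]. In
    the quadrilateral [y, f i, f j, z], the sides at [y] and [z] are too far
    from [v], so [v] is close to a point between [f i] and [f j]. The number of
    steps of [f] from [i] to [j] is linear in [D], so [chain_near_geodesic]
    bounds the distance from [v] to [f], hence [D], by the logarithm of a linear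
    function of [D]. *)
Theorem geodesic_near_quasigeodesic M lambda eps :
  exists R, forall N f, quasigeodesic M lambda eps N f ->
  forall v, between (f 0%N) v (f N) -> exists2 j, j <= N & wd R v (f j).
Proof.
have [R RP] := log_lt_linear delta (2 * delta + M) (lambda * 4)
  (lambda * (4 * delta + 2) + eps).
exists (R + 2 * delta)%N => N f [step lower].
have exD : exists D, `[< forall v, between (f 0%N) v (f N) ->
    exists2 j, j <= N & wd D v (f j) >].
  have [D DP] := wd_exists Agen (f 0%N) (f N); exists D; apply/asboolP => v vb.
  by exists N => //; have [] := between_wd vb DP.
case: (ex_minnP exD) => D /asboolP DP Dmin.
suff DR : D <= R + 2 * delta.
  by move=> v /DP [j jN vj]; exists j => //; apply: wd_leq vj.
rewrite leqNgt; apply/negP => D_big.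
have [v vb far] : exists2 v, between (f 0%N) v (f N) &
    forall j, j <= N -> ~ wd D.-1 v (f j).
  apply: contrapT => H.
  have : D <= D.-1 by apply/Dmin/asboolP => v vb; apply: contrapT => Hv;
    apply: H; exists v => // j jN vj; apply: Hv; exists j.
  by lia.
pose E := (D + 2 * delta + 1)%N.
(* One flank of the quadrilateral, used from both ends.  If the walk back from
   [v] stops at the end [f i0], the side from [y] to [f i0] is a point. *)
have flank x i0 z : i0 <= N -> x = f i0 -> between x v z ->
  (forall u, between x u z -> between (f 0%N) u (f N)) ->
  exists y i, [/\ i <= N, between (f 0%N) y (f N), between y v z,
    wd D y (f i) & wd E y v /\
    forall t, between y t (f i) -> ~ wd (2 * delta) v t].
  move=> i0N xE xv sub; have [y [yb yv Ey yE]] := between_before E xv.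
  have [yx|yfar] := yE.
    exists y, i0; split=> //; first exact: sub.
      by rewrite yx xE; apply: wd_refl.
    split=> // t; rewrite yx xE => /between_wd /(_ (wd_refl _ 0%N _)) [_ tf] vt.
    apply: (far i0 i0N); apply: wd_leq (wd_trans vt tf); lia.
  have [i iN yi] := DP y (sub _ yb).
  exists y, i; split=> //; first exact: sub.
  split=> // t /between_wd /(_ yi) [yt tf] vt.
  have := yfar _ (wd_trans yt (wd_sym Asym vt)); rewrite /E; lia.
have [y [i [iN yb yv yi [yE yfar]]]] :=
  flank _ 0%N _ (leq0n N) erefl vb (fun u => id).
have [|z [j [jN zb zv zj [zE zfar]]]] :=
  flank _ N y (leqnn N) erefl (between_sym Asym yv).
  by move=> u /(between_sym Asym); apply: between_right.
have [t tb vt] := between_quadrilateral A_gen slim (f i) (f j)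
  (between_sym Asym zv).
have far_mid : forall i j, i <= j <= N -> wd (2 * D + 2 * E) (f i) (f j) ->
    between (f i) t (f j) -> False.
  move=> {flank y i iN yb yv yi yE yfar z j jN zb zv zj zE zfar tb}.
  move=> i j ijN dij tb.
  have := lower _ _ _ ijN dij => {dij} le.
  have : j - i <=
      2 ^ up_log 2 (lambda * 4 * D + (lambda * (4 * delta + 2) + eps)).
    apply: leq_trans (up_logP _ _) => //; apply: leq_trans le _.
    have -> : 2 * D + 2 * E = 4 * D + (4 * delta + 2) by rewrite /E; lia.
    by rewrite mulnDr mulnA addnA.
  have e : f j = f (i + (j - i)) by congr f; lia.
  rewrite e in tb.
  move=> /(chain_near_geodesic A_gen slim (M := M)) /(_ tb) [k kj|k kN tk].
    by apply: step; lia.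
  apply: (far k); first lia.
  apply: wd_leq (wd_trans vt tk).
  by have := RP D ltac:(lia); rewrite mulnC; lia.
have dij : wd (2 * D + 2 * E) (f i) (f j).
  have yv_i := wd_trans (wd_sym Asym yi) yE.
  have := wd_trans yv_i (wd_trans (wd_sym Asym zE) zj).
  by apply: wd_leq; lia.
case: tb => [tb|tb|/(between_sym Asym) tb].
- exact: (yfar t).
- have [ij|/ltnW ji] := leqP i j.
    have ijN : i <= j <= N by rewrite ij jN.
    exact: far_mid ijN dij tb.
  have jiN : j <= i <= N by rewrite ji iN.
  exact: far_mid jiN (wd_sym Asym dij) (between_sym Asym tb).
- exact: (zfar t).
Qed.
End Morse.

(** * Hyperbolicity of free products *)

Section Projection.
Variables (G1 G2 G : groupType).
Variables (i1 : {multiplicative G1 -> G}) (i2 : {multiplicative G2 -> G}).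
Variable pi : G -> G1.
Hypothesis piP : is_projection i1 i2 pi.

Lemma proj_factor a : pi (i1 a) = a.
Proof. by case: piP => H1 H2 _ _; rewrite -[i1 a]mulg1 H1 H2 mulg1. Qed.

Lemma factor_inj : injective i1.
Proof. exact: can_inj proj_factor. Qed.

Lemma proj_other b : pi (i2 b) = 1.
Proof. by case: piP => _ H2 _ H; rewrite -[i2 b]mul1g H. Qed.

Definition in_factor (w : G) : bool := w == i1 (pi w).

Lemma in_factorP w : reflect (exists c, w = i1 c) (in_factor w).
Proof.
apply: (iffP eqP) => [|[c ->]]; last by rewrite proj_factor.
by exists (pi w).
Qed.

Variables (A1 : seq G1) (A2 : seq G2).
Hypothesis A1sym : forall a, a \in A1 -> a^-1 \in A1.
Hypothesis A2sym : forall a, a \in A2 -> a^-1 \in A2.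

Variable A : seq G.
Hypothesis AE : A =i [seq i1 a | a <- A1] ++ [seq i2 b | b <- A2].

Lemma join_gens_sym a : a \in A -> a^-1 \in A.
Proof.
rewrite !AE !mem_cat => /orP[] /mapP[b bA ->]; rewrite -mulfV.
  by rewrite map_f ?A1sym.
by rewrite [in X in _ || X]map_f ?orbT ?A2sym.
Qed.

Lemma proj_edge x y : cayley A x y -> ~~ in_factor x -> pi y = pi x.
Proof.
move=> e /in_factorP nx; case: piP => _ _ H1 H2; rewrite -[y](mulVKg x).
by move: e; rewrite /cayley /= AE mem_cat => /orP[] /mapP[b _ ->];
  rewrite ?H1 ?H2.
Qed.

(** Edges labelled by the other factor are loops once projected. *)
Lemma factor_edge g h : g != h -> cayley A (i1 g) (i1 h) -> cayley A1 g h.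
Proof.
rewrite /cayley /= -mulfV -gmulfM AE mem_cat => gh /orP[] /mapP[b bA e].
  by rewrite (factor_inj e).
have := proj_factor (g^-1 * h); rewrite e proj_other => /esym/mulg1_eq.
by rewrite invgK => /eqP; rewrite (negPf gh).
Qed.

Lemma factor_path g p : path (cayley A1) g p ->
  path (cayley A) (i1 g) (map i1 p).
Proof.
elim: p g => //= a p IH g /andP[e /IH ->]; rewrite andbT.
by rewrite /cayley /= -mulfV -gmulfM AE mem_cat map_f.
Qed.

(** Outside the factor [pi] is constant along edges.  So a path leaving [i1 G1]
    at a vertex can only come back at the same vertex, which injectivity
    forbids: the vertices in the factor form one block. *)
Lemma path_in_factor x p : path (cayley A) x p -> uniq (x :: p) ->
  pi x = pi (last x p) /\ {in x :: p, forall v, ~~ in_factor v} \/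
  exists s p' t, [/\ x :: p = s ++ [seq i1 g | g <- pi x :: p'] ++ t,
    {in s ++ t, forall v, ~~ in_factor v},
    path (cayley A1) (pi x) p' & last (pi x) p' = pi (last x p)].
Proof.
elim: p x => [|a p IH] x.
  have [xC _ _|nx _ _] := boolP (in_factor x); [right | left].
    by exists [::], [::], [::]; split=> //=; rewrite -(eqP xC).
  by split=> // v; rewrite inE => /eqP ->.
move=> /andP[e pp]; rewrite cons_uniq => /andP[xap up].
have {IH} := IH _ pp up.
have [xC|nx] := boolP (in_factor x); last first.
  rewrite /= (proj_edge e nx) => -[[l n]|[s [p' [t [E n pp' lp']]]]];
    [left|right].
    by split=> // v; rewrite in_cons => /orP[/eqP->|/n].
  exists (x :: s), p', t; split=> //; first by rewrite E.
  by move=> v; rewrite in_cons => /orP[/eqP->|/n].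
right; have [aC|na] := boolP (in_factor a); last first.
  have pa := proj_edge (cayley_sym join_gens_sym e) na.
  move: H => [[l n]|[s [p' [t [E n pp' lp']]]]].
    by exists [::], [::], (a :: p); rewrite /= -(eqP xC) -l -pa.
  by case/negP: xap; rewrite E !mem_cat /= -pa -(eqP xC) mem_head orbT.
have {xap} ne : pi x != pi a.
  by apply: contra xap => /eqP pxa; rewrite (eqP xC) pxa -(eqP aC) mem_head.
case: H => [[_ /(_ a (mem_head _ _))]|]; first by rewrite aC.
move=> [[|b s] [p' [t [E n pp' lp']]]]; last first.
  by have := n a; rewrite aC; move: E => /= [-> _];
    rewrite mem_head => /(_ isT).
exists [::], (pi a :: p'), t; split=> //=.
  by rewrite -(eqP xC) E.
by rewrite pp' andbT; apply: factor_edge; rewrite // -(eqP xC) -(eqP aC).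
Qed.

(** Paths of [G1] map to paths of [G] of the same length, so the block of
    [path_in_factor] is not longer than any path of [G1] with the same ends. *)
Lemma geodesic_in_factor x y p : geodesic A x y p ->
  pi x = pi y /\ {in x :: p, forall v, ~~ in_factor v} \/
  exists2 p', geodesic A1 (pi x) (pi y) p' &
    forall g, (i1 g \in x :: p) = (g \in pi x :: p').
Proof.
move=> gp; have [[pp lp] _] := gp.
have [[]|[s [p' [t [E n pp' lp']]]]] := path_in_factor pp (geodesic_uniq gp).
  by left; rewrite -lp.
right; exists p'; last first.
  move=> g; rewrite E !mem_cat mem_map; last exact: factor_inj.
  have : ~~ (i1 g \in s ++ t).
    by apply/negP => /n; rewrite /in_factor proj_factor eqxx.
  by rewrite mem_cat negb_or => /andP[/negPf -> /negPf ->]; rewrite orbF.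
split; first by rewrite -lp.
move=> q [pq lq]; have [_ /(_ (map i1 q))] := geodesic_infix gp E.
rewrite !size_map; apply; split; first exact: factor_path.
by rewrite !last_map lq lp' lp.
Qed.

Lemma factor_wd n g h : word_dist_le A1 n g h -> word_dist_le A n (i1 g) (i1 h).
Proof.
move=> [p [pp <-] sp]; exists (map i1 p); last by rewrite size_map.
by split; [exact: factor_path | rewrite last_map].
Qed.

(** The condition on [v] makes the block of [p] in the factor nontrivial.  The
    three blocks form a geodesic triangle of [G1] through [1].  A side that
    misses the factor has its ends projected to one point; at most one side does
    so, and that point is then on the block of the third side. *)
Lemma slim_at_factor delta x y z p q r v : slim_triangles A1 delta ->
  geodesic A x y p -> geodesic A y z q -> geodesic A z x r ->
  1 \in x :: p -> v \in x :: p -> v != 1 -> in_factor v ->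
  exists2 w, (w \in y :: q) || (w \in z :: r) & word_dist_le A delta 1 w.
Proof.
move=> slim gp gq gr u_p v_p v1 /eqP vC.
have [[_ /(_ _ v_p)]|[p' gp' pE]] := geodesic_in_factor gp.
  by rewrite /in_factor {1}vC eqxx.
move: u_p v_p; rewrite -(mulf1 i1) vC !pE => u_p v_p.
have nxy : pi x != pi y.
  apply/eqP => xy; have := geodesic_leq (n := 0) gp'; rewrite xy leqn0.
  move=> /(_ (wd_refl _ _ _)) /eqP/size0nil p0; move: u_p v_p.
  by rewrite p0 !inE => /eqP <- /eqP v2; move: v1; rewrite vC v2 mulf1 eqxx.
have geo_nil g h : g = h -> geodesic A1 g h [::] by move=> ->; do 2!split.
have [w wqr uw] : exists2 w, (i1 w \in y :: q) || (i1 w \in z :: r)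
  & word_dist_le A1 delta 1 w.
  have [[yz _]|[q' gq' qE]] := geodesic_in_factor gq;
  have [[zx _]|[r' gr' rE]] := geodesic_in_factor gr.
  - by move: nxy; rewrite yz zx eqxx.
  - have [w wP uw] := slim _ _ _ _ _ _ gp' (geo_nil _ _ yz) gr' _ u_p.
    exists w => //; rewrite rE; case/orP: wP => [|->]; last by rewrite orbT.
    by rewrite inE => /eqP ->; rewrite yz mem_head orbT.
  - have [w wP uw] := slim _ _ _ _ _ _ gp' gq' (geo_nil _ _ zx) _ u_p.
    exists w => //; rewrite qE; case/orP: wP => [->//|].
    by rewrite inE => /eqP ->; case: gq' => -[_ <-] _; rewrite mem_last.
  - have [w wP uw] := slim _ _ _ _ _ _ gp' gq' gr' _ u_p.
    by exists w => //; rewrite qE rE.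
by exists (i1 w) => //; apply: factor_wd.
Qed.
End Projection.

Lemma path_neighbour (T : eqType) (e : rel T) x p u : path e x p ->
  uniq (x :: p) -> p != [::] -> u \in x :: p ->
  exists2 v, v \in x :: p & (e u v || e v u) && (v != u).
Proof.
case: p => // a p pp + _; rewrite in_cons => up /orP[/eqP->|uin].
  exists a; first by rewrite ?in_cons ?eqxx ?orbT.
  case/andP: pp => -> _ /=; apply: contraTneq up => ->.
  by rewrite /= mem_head.
move: pp up; case/splitPr: uin => p1 p2; rewrite cat_path /= => /and3P[_ eu _].
rewrite -[_ && _]/(uniq ((x :: p1) ++ u :: p2)) cat_uniq =>
  /and3P[_ /hasPn n _].
exists (last x p1); first by rewrite -cat_cons mem_cat mem_last.
rewrite eu orbT /=; apply: contraTneq (n u (mem_head _ _)) => <-.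
by rewrite negbK mem_last.
Qed.

Theorem free_product_hyperbolic (G1 G2 G : groupType)
    (i1 : {multiplicative G1 -> G}) (i2 : {multiplicative G2 -> G}) :
  is_free_product i1 i2 -> hyperbolic_group G1 -> hyperbolic_group G2 ->
  hyperbolic_group G.
Proof.
move=> U [A1 [[s1 g1] [d1 sl1]]] [A2 [[s2 g2] [d2 sl2]]].
have [pi1 pi1P] := projection_exists U.
have [pi2 pi2P] := projection_exists (free_product_sym U).
pose A := [seq i1 a | a <- A1] ++ [seq i2 b | b <- A2].
have AE1 : A =i [seq i1 a | a <- A1] ++ [seq i2 b | b <- A2] by [].
have AE2 : A =i [seq i2 b | b <- A2] ++ [seq i1 a | a <- A1].
  by move=> x; rewrite !mem_cat orbC.
have Asym := join_gens_sym s1 s2 AE1.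
exists A; split.
  split=> // w; elim/(free_product_ind U): w => [|w a [s sA ->]|w b [s sA ->]].
  - by exists [::]; rewrite ?big_nil.
  - have [t tA ->] := g1 a; exists (s ++ map i1 t).
      move=> x; rewrite mem_cat => /orP[/sA //|/mapP[c /tA cA ->]].
      by rewrite mem_cat map_f.
    by rewrite mulf_prod big_cat.
  - have [t tA ->] := g2 b; exists (s ++ map i2 t).
      move=> x; rewrite mem_cat => /orP[/sA //|/mapP[c /tA cA ->]].
      by rewrite mem_cat (map_f _ cA) orbT.
    by rewrite mulf_prod big_cat.
exists (maxn d1 d2) => x y z p q r gp gq gr u up.
have [p0|pn0] := eqVneq p [::].
  exists u; last exact: wd_refl.
  by move: up; rewrite p0 inE; case: gp => -[]; rewrite p0 /= => _ -> _ /eqP ->;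
    rewrite mem_head.
have [v [vp euv vu]] : exists v, [/\ v \in x :: p, cayley A u v & v != u].
  have [[pp _] _] := gp.
  have [v vp /andP[uv vu]] := path_neighbour pp (geodesic_uniq gp) pn0 up.
  by exists v; split=> //; case/orP: uv => // /(cayley_sym Asym).
(* translate [u] to [1], so that its edge to [v] lies in a factor *)
pose f z := u^-1 * z.
have [gp' gq' gr'] := And3 (geodesic_mul u^-1 gp) (geodesic_mul u^-1 gq)
  (geodesic_mul u^-1 gr).
have mf t s w : w \in t :: s -> f w \in f t :: map f s by move/(map_f f).
have vp' := mf _ _ _ vp.
have up' : 1 \in f x :: map f p by rewrite -(mulVg u) mf.
have v1 : f v != 1 by rewrite -(mulVg u) (inj_eq (@mulgI _ _)).
have [w wP uw] : exists2 w, (w \in f y :: map f q) || (w \in f z :: map f r)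
  & word_dist_le A (maxn d1 d2) 1 w.
  move: euv; rewrite /cayley /= AE1 mem_cat => /orP[] /mapP[b _ e].
    have [|w wP uw] := slim_at_factor pi1P s1 s2 AE1 sl1 gp' gq' gr' up' vp' v1.
      by apply/(in_factorP pi1P); exists b.
    by exists w => //; apply: wd_leq uw; rewrite leq_maxl.
  have [|w wP uw] := slim_at_factor pi2P s2 s1 AE2 sl2 gp' gq' gr' up' vp' v1.
    by apply/(in_factorP pi2P); exists b.
  by exists w => //; apply: wd_leq uw; rewrite leq_maxr.
have fI : injective f by exact: mulgI.
exists (u * w); last by apply/wd_one; rewrite mulKg.
have : (f (u * w) \in map f (y :: q)) || (f (u * w) \in map f (z :: r)).
  by rewrite /f mulKg.
by rewrite !(mem_map fI).
Qed.

(** * Separability from finite actions of the factors *)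

Lemma finite_index_fiber (G : groupType) (T : eqType) (N : set G)
    (phi : G -> T) (s : seq T) :
  (forall g, phi g \in s) -> (forall g h, phi g = phi h -> N (g^-1 * h)) ->
  finite_index N.
Proof.
move=> phis phiN.
have [r rP] : exists r : seq G, forall g, phi g \in s ->
    exists2 t, t \in r & phi t = phi g.
  elim: s {phis} => [|a s [r rP]]; first by exists [::].
  have [[t ta]|na] := pselect (exists t, phi t = a).
    exists (t :: r) => g; rewrite in_cons => /orP[/eqP ->|/rP[u ur ug]].
      by exists t; rewrite ?mem_head.
    by exists u; rewrite ?in_cons ?ur ?orbT.
  exists r => g; rewrite in_cons => /orP[/eqP ga|/rP //].
  by case: na; exists g.
by exists r => g; have [t tr /phiN] := rP g (phis g); exists t.
Qed.

Definition normal_finite_index (G : groupType) (N : set G) : Prop :=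
  [/\ is_subgroup N, is_normal N & finite_index N].

Lemma normal_finite_indexT (G : groupType) : normal_finite_index (@setT G).
Proof. by split; [split| |exists [:: 1] => g; exists 1; rewrite ?mem_head]. Qed.

Lemma normal_finite_indexI (G : groupType) (M N : set G) :
  normal_finite_index M -> normal_finite_index N ->
  normal_finite_index (M `&` N).
Proof.
move=> [[M1 MM MV] Mn [s sP]] [[N1 NM NV] Nn [t tP]]; split.
- split=> [//|x y [? ?] [? ?]|x [? ?]]; split; auto.
- by move=> x g [? ?]; split; auto.
have sP' g : exists u, u \in s /\ M (u^-1 * g) by have [u] := sP g; exists u.
have tP' g : exists u, u \in t /\ N (u^-1 * g) by have [u] := tP g; exists u.
have [a aP] := choice sP'; have [b bP] := choice tP'.
apply: (@finite_index_fiber _ _ _ (fun g => (a g, b g)) (allpairs pair s t)).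
  by move=> g; apply/allpairsP; exists (a g, b g); case: (aP g); case: (bP g).
move=> g h [ea eb]; split.
  have [_ g1] := aP g; have [_ h1] := aP h; rewrite ea in g1.
  by have := MM _ _ (MV _ g1) h1; rewrite invgM invgK -mulgA mulVKg.
have [_ g1] := bP g; have [_ h1] := bP h; rewrite eb in g1.
by have := NM _ _ (NV _ g1) h1; rewrite invgM invgK -mulgA mulVKg.
Qed.

Lemma kernel_normal_finite_index (G : groupType) n
    (f : {multiplicative G -> 'S_n}) :
  normal_finite_index [set g | f g = 1].
Proof.
split.
- split=> [|x y /= ex ey|x /= ex] /=; first exact: mulf1.
    by rewrite gmulfM ex ey mulg1.
  by rewrite mulfV ex invg1.
- by move=> x g /= ex; rewrite /conjg !gmulfM ex mul1g mulfV mulVg.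
apply: (@finite_index_fiber _ _ _ f (enum 'S_n)) => [g|g h e].
  by rewrite mem_enum.
by rewrite /= gmulfM mulfV e mulVg.
Qed.

(** Replacing points by their positions in [L], and fixing the positions beyond
    [L], lets actions on unrelated finite sets live on the same ['I_n]. *)
Lemma action_on_positions (G : groupType) (T : eqType) (act : G -> T -> T)
    (z0 : T) (L : seq T) n :
  (forall z, act 1 z = z) -> (forall a b z, act (a * b) z = act b (act a z)) ->
  uniq L -> (forall a z, z \in L -> act a z \in L) -> size L <= n ->
  exists f : {multiplicative G -> 'S_n}, forall a (k l : 'I_n),
    k < size L -> l < size L -> act a (nth z0 L k) = nth z0 L l -> f a k = l.
Proof.
move=> act1 actM uL actL Ln.
pose F a k := if k < size L then index (act a (nth z0 L k)) L else k.
have Flt a k : k < n -> F a k < n.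
  rewrite /F; case: ifP => // kL _; apply: leq_trans Ln.
  by rewrite index_mem actL ?mem_nth.
pose Fo a (k : 'I_n) := Ordinal (Flt a k (ltn_ord k)).
have FM a b k : Fo (a * b) k = Fo b (Fo a k).
  apply: val_inj; rewrite /= /F; case: ifP => [kL|->//].
  have h : act a (nth z0 L k) \in L by rewrite actL ?mem_nth.
  by rewrite index_mem h nth_index // actM.
have F1 k : Fo 1 k = k.
  by apply: val_inj; rewrite /= /F; case: ifP => // kL; rewrite act1 index_uniq.
have FK a : cancel (Fo a) (Fo a^-1) by move=> k; rewrite -FM mulgV F1.
pose f a : 'S_n := perm (can_inj (FK a)).
have fM : {morph f : x y / x * y}.
  by move=> x y; apply/permP => k; rewrite permM !permE FM.
exists (multiplicative_of fM) => a k l kL lL e; rewrite permE.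
by apply: val_inj; rewrite /= /F kL e index_uniq.
Qed.

Section Burns.
Variables (G : groupType) (H : set G).
Hypothesis Hsub : is_subgroup H.

Let H1 : H 1. Proof. by case: Hsub. Qed.
Let HM x y : H x -> H y -> H (x * y). Proof. by case: Hsub => _ + _; apply. Qed.
Let HV x : H x -> H x^-1. Proof. by case: Hsub => _ _; apply. Qed.

(** [G1] acts on [H\G] by right multiplication through [i]; this is the
    stabilizer of the coset [H x]. *)
Definition coset_stabilizer (G1 : groupType) (i : {multiplicative G1 -> G})
    (x : G) : set G1 := [set a | H (x * i a * x^-1)].

(** The elements of [Y] represent pairwise distinct points of [H\G]. *)
Definition independent (Y : seq G) : Prop :=
  uniq Y /\ {in Y &, forall y y', H (y * y'^-1) -> y = y'}.

Section OneFactor.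
Variables (G1 : groupType) (i : {multiplicative G1 -> G}).
Hypothesis closed : forall x, profinite_closed (coset_stabilizer i x).

(** For [y <> y'], the elements of [G1] moving [H y] to [H y'] form an empty set
    or a coset [K a0] of the stabilizer [K] of [H y], with [a0] outside [K]. As
    [K] is closed, some [a0 N] misses [K], so that [N] misses [K a0]; intersect
    these subgroups over the finitely many pairs. *)
Lemma separating_subgroup (Y : seq G) : independent Y ->
  exists2 N : set G1, normal_finite_index N &
    {in Y &, forall y y' n, N n -> H (y * i n * y'^-1) -> y = y'}.
Proof.
move=> [_ Yind].
suff [N gN NP] : exists2 N : set G1, normal_finite_index N &
    forall t, t \in allpairs pair Y Y ->
    forall n, N n -> H (t.1 * i n * t.2^-1) -> t.1 = t.2.
  exists N => // y y' yY y'Y; apply: (NP (y, y')).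
  by apply/allpairsP; exists (y, y').
have tY t : t \in allpairs pair Y Y -> t.1 \in Y /\ t.2 \in Y.
  by move=> /allpairsP[[y y'] [? ? ->]].
elim: (allpairs pair Y Y) tY => [|[y y'] s IH] tY.
  by exists setT; [exact: normal_finite_indexT|].
have [N gN NP] := IH (fun t ts => tY t (mem_behead (s := _ :: _) ts)).
suff [M gM MP] : exists2 M : set G1, normal_finite_index M &
    forall n, M n -> H (y * i n * y'^-1) -> y = y'.
  exists (M `&` N); first exact: normal_finite_indexI.
  by move=> t; rewrite in_cons => /orP[/eqP->|/NP h] n [Mn Nn];
    [apply: MP Mn | apply: h Nn].
have [yY y'Y] := tY _ (mem_head _ _).
have [[a0 Ha0]|na] := pselect (exists a, H (y * i a * y'^-1)); last first.
  by exists setT; [exact: normal_finite_indexT|] => n _ hn; case: na; exists n.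
have [e|ne] := pselect (y = y').
  by exists setT; [exact: normal_finite_indexT|].
have [M [M1 M2 M3 MP]] : exists M : set G1,
    [/\ is_subgroup M, is_normal M, finite_index M &
        [set a0 * n | n in M] `<=` ~` coset_stabilizer i y].
  apply: closed => /HV Hy; apply: ne; apply: Yind => //.
  by have := HM Hy Ha0; rewrite !invgM !invgK -!mulgA !mulKg.
exists M => // n Mn Hn.
case: (MP (a0 * n^-1)); first by exists n^-1 => //; case: M1 => _ _; apply.
have := HM Ha0 (HV Hn).
by rewrite /coset_stabilizer /= !invgM !invgK gmulfM mulfV !mulgA mulgVK.
Qed.

(** With [N] separating [Y], the points of [Y] stay distinct in the quotient of
    [H\G] by [N]. Since [N] is normal, [G1] acts on this quotient, through the
    finite group [G1 / N], so the orbits of the points of [Y] form a finite set.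
    Listing the points of [Y] first keeps the positions they have in [Y]. *)
Lemma finite_local_action (Y : seq G) : independent Y ->
  exists n0, forall n, n0 <= n -> size Y <= n /\
  exists f : {multiplicative G1 -> 'S_n}, forall a (k l : 'I_n),
    k < size Y -> l < size Y -> H (nth 1 Y k * i a * (nth 1 Y l)^-1) ->
      f a k = l.
Proof.
move=> Yind; have [N [[N1 NM NV] Nn [s sP]] NY] := separating_subgroup Yind.
(* the class of [H x] modulo [N], as the union [H x (i N)] of cosets *)
pose q x : set G := [set z | exists2 n, N n & H (z * i n * x^-1)].
have qP x y n : N n -> H (x * i n * y^-1) -> q x = q y.
  move=> Nm h; apply/seteqP; split=> z [m Nm' hz].
    exists (m * n); first exact: NM.
    by have := HM hz h; rewrite !mulgA mulgVK -[_ * i m * _]mulgA -gmulfM.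
  exists (m * n^-1); first by apply: NM => //; apply: NV.
  have := HM hz (HV h).
  by rewrite !invgM !invgK !mulgA mulgVK -[_ * i m * _]mulgA -mulfV -gmulfM.
have qE x y : q x = q y -> exists2 n, N n & H (x * i n * y^-1).
  move=> e; have: q y x; last by [].
  by rewrite -e; exists 1 => //; rewrite mulf1 mulg1 mulgV.
pose act a (Z : set G) : set G := [set z | Z (z * (i a)^-1)].
have actq a x : act a (q x) = q (x * i a).
  apply/seteqP; split=> z [n Nm hz].
    exists (n ^ a); first exact: Nn.
    by rewrite /conjg !gmulfM mulfV invgM !mulgA mulgK.
  exists (n ^ a^-1); first exact: Nn.
  rewrite invgM !mulgA in hz.
  by rewrite /conjg invgK !gmulfM mulfV !mulgA mulgVK.
have act1 Z : act 1 Z = Z.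
  by apply/seteqP; split=> z; rewrite /act /= mulf1 invg1 mulg1.
have actM a b Z : act (a * b) Z = act b (act a Z).
  by apply/seteqP; split=> z; rewrite /act /= gmulfM invgM mulgA.
pose L1 := map q Y.
pose L2 := [seq z <- undup [seq q (y * i t) | y <- Y, t <- s] | z \notin L1].
have uL1 : uniq L1.
  rewrite map_inj_in_uniq; first by case: Yind.
  by move=> y y' yY y'Y /qE[n Nm]; apply: NY.
have uL : uniq (L1 ++ L2).
  rewrite cat_uniq uL1 filter_uniq ?undup_uniq // andbT.
  by apply/hasPn => z; rewrite mem_filter => /andP[].
have inL y g : y \in Y -> q (y * i g) \in L1 ++ L2.
  move=> yY; have [t ts Nt] := sP g.
  have -> : q (y * i g) = q (y * i t).
    apply: (@qP _ _ (t^-1 * g)^-1); first exact: NV.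
    by rewrite invgM invgK gmulfM mulfV !mulgA mulgK invgM !mulgA mulgK mulgV.
  rewrite mem_cat mem_filter mem_undup; case: (q _ \in L1) => //=.
  by apply/allpairsP; exists (y, t).
have Linv z : z \in L1 ++ L2 -> exists y g, y \in Y /\ z = q (y * i g).
  rewrite mem_cat mem_filter mem_undup => /orP[/mapP[y yY ->]|/andP[_]].
    by exists y, 1; rewrite mulf1 mulg1.
  by move=> /allpairsP[[y t] [yY _ ->]]; exists y, t.
exists (size (L1 ++ L2)) => n Ln.
have sY : size Y = size L1 by rewrite size_map.
split; first by apply: leq_trans Ln; rewrite size_cat -sY leq_addr.
have [|f fP] := action_on_positions set0 act1 actM uL _ Ln.
  by move=> a z /Linv[y [g [yY ->]]]; rewrite actq -mulgA -gmulfM inL.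
exists f => a k l kY lY h; apply: fP.
- by rewrite size_cat -sY ltn_addr.
- by rewrite size_cat -sY ltn_addr.
rewrite !nth_cat -sY kY lY !(nth_map 1) // actq; apply: (qP _ _ 1) => //.
by rewrite mulf1 mulg1.
Qed.
End OneFactor.

Lemma independent_cover (P : seq G) : exists2 Y, independent Y &
  forall x, x \in P -> exists2 y, y \in Y & H (x * y^-1).
Proof.
elim: P => [|x P [Y [uY Yi] YP]]; first by exists [::]; first split.
have [[y yY xy]|nx] := pselect (exists2 y, y \in Y & H (x * y^-1)).
  by exists Y => // z; rewrite in_cons => /orP[/eqP ->|/YP //]; exists y.
exists (x :: Y).
  split.
    rewrite /= uY andbT; apply/negP => xY; apply: nx; exists x => //.
    by rewrite mulgV.
  move=> y y'; rewrite !in_cons.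
  move=> /orP[/eqP->|yY] /orP[/eqP->|y'Y] // h; last exact: Yi.
    by case: nx; exists y'.
  by case: nx; exists y => //; have := HV h; rewrite invgM invgK.
move=> z; rewrite in_cons => /orP[/eqP->|/YP[y yY h]].
  by exists x; rewrite ?mem_head // mulgV.
by exists y; rewrite // in_cons yY orbT.
Qed.

Variables (G1 G2 : groupType).
Variables (i1 : {multiplicative G1 -> G}) (i2 : {multiplicative G2 -> G}).
Hypothesis U : is_free_product i1 i2.

(** One step per syllable: a path from [1] lists the prefixes of a product. *)
Definition factor_step : rel G := [rel x y |
  `[< (exists a, y = x * i1 a) \/ (exists b, y = x * i2 b) >]].

Lemma factor_step_path w : exists2 p, path factor_step 1 p & last 1 p = w.
Proof.
elim/(free_product_ind U): w => [|w a [p pp <-]|w b [p pp <-]].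
- by exists [::].
- exists (rcons p (last 1 p * i1 a)); last by rewrite last_rcons.
  by rewrite rcons_path pp /=; apply/asboolP; left; exists a.
- exists (rcons p (last 1 p * i2 b)); last by rewrite last_rcons.
  by rewrite rcons_path pp /=; apply/asboolP; right; exists b.
Qed.

(** The two actions of [finite_local_action] use the same positions for the
    points of [Y], so the resulting action of [G] follows the syllables of the
    generators and of [g] as in [H\G]. Thus [H] fixes the position of [H]
    itself, while [g] sends it to the position of [H g], which is a different
    one. *)
Theorem closed_of_stabilizers_closed (S : seq G) :
  (forall x, x \in S -> H x) ->
  (forall h, H h -> exists2 w, {subset w <= S} & h = \prod_(a <- w) a) ->
  (forall x, profinite_closed (coset_stabilizer i1 x)) ->
  (forall x, profinite_closed (coset_stabilizer i2 x)) ->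
  profinite_closed H.
Proof.
move=> SH Sgen cl1 cl2 g gH.
have [P PP] : exists P : seq G, forall w, w \in g :: S ->
    exists p, [/\ path factor_step 1 p, last 1 p = w & {subset 1 :: p <= P}].
  elim: (g :: S) => [|a s [P PP]]; first by exists [::].
  have [p pp lp] := factor_step_path a.
  exists ((1 :: p) ++ P) => w; rewrite in_cons => /orP[/eqP ->|/PP[r [? ? rP]]].
    by exists p; split=> // x xp; rewrite mem_cat xp.
  by exists r; split=> // x /rP xP; rewrite mem_cat xP orbT.
have [Y Yind YP] := independent_cover P.
(* [k] is the position of the coset [H x] *)
pose num x k := k < size Y /\ H (x * (nth 1 Y k)^-1).
have numE x : x \in P -> exists k, num x k.
  move=> /YP[y yY h]; exists (index y Y); split; first by rewrite index_mem.
  by rewrite nth_index.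
have numU x k l : num x k -> num x l -> k = l.
  move=> [kY hk] [lY hl]; case: Yind => uY Yi; apply/eqP.
  rewrite -(nth_uniq 1 kY lY uY); apply/eqP; apply: Yi; rewrite ?mem_nth //.
  by have := HM (HV hk) hl; rewrite invgM invgK -mulgA mulKg.
have numH h x k : H h -> num x k -> num (h * x) k.
  by move=> hh [kY hk]; split=> //; rewrite -mulgA; apply: HM.
have [n1 n1P] := finite_local_action cl1 Yind.
have [n2 n2P] := finite_local_action cl2 Yind.
pose n := maxn n1 n2.
have [Yn [f1 f1P]] := n1P n (leq_maxl _ _).
have [_ [f2 f2P]] := n2P n (leq_maxr _ _).
have [f [e1 e2 _]] := U f1 f2.
have step x y k l : factor_step x y ->
    num x (nat_of_ord k) -> num y (nat_of_ord l) ->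
    f (x^-1 * y) k = l :> 'I_n.
  move=> /asboolP st [kY hk] [lY hl].
  have hkl : H (nth 1 Y k * (x^-1 * y) * (nth 1 Y l)^-1).
    by have := HM (HV hk) hl; rewrite invgM invgK !mulgA.
  case: st => -[a ya]; move: hkl; rewrite ya mulKg => hkl.
    by have /= -> := e1 a; apply: f1P.
  by have /= -> := e2 a; apply: f2P.
have trace x p k l : path factor_step x p -> {subset x :: p <= P} ->
    num x (nat_of_ord k) -> num (last x p) (nat_of_ord l) ->
    f (x^-1 * last x p) k = l :> 'I_n.
  elim: p x k => [|a p IH] x k /=.
    move=> _ _ hk hl; rewrite mulVg mulf1 perm1.
    by apply: val_inj; apply: numU hk hl.
  move=> /andP[e pp] sub hk hl.
  have [m hm] : exists m, num a m by apply/numE/sub; rewrite !in_cons eqxx orbT.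
  have mn : m < n by apply: leq_trans Yn; case: hm.
  have -> : x^-1 * last a p = (x^-1 * a) * (a^-1 * last a p).
    by rewrite -mulgA mulVKg.
  rewrite gmulfM permM (step x a k (Ordinal mn)) //; apply: IH => //.
  by move=> z zp; apply: sub; rewrite in_cons zp orbT.
have P1 : 1 \in P.
  by have [p [_ _]] := PP g (mem_head _ _); apply; rewrite mem_head.
have [k0 k0P] := numE 1 P1.
have k0n : k0 < n by apply: leq_trans Yn; case: k0P.
pose o : 'I_n := Ordinal k0n.
have tr w l : w \in g :: S -> num w (nat_of_ord l) -> f w o = l :> 'I_n.
  move=> /PP[p [pp lp pP]] wl; have := trace 1 p o l pp pP k0P.
  by rewrite lp invg1 mul1g; apply.
have fS s : s \in S -> f s o = o.
  move=> sS; apply: tr; first by rewrite in_cons sS orbT.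
  by rewrite -[s]mulg1; apply: numH => //; apply: SH.
have fH h : H h -> f h o = o.
  move=> /Sgen[w wS ->]; elim: w wS => [|a w IH] wS.
    by rewrite big_nil mulf1 perm1.
  rewrite big_cons gmulfM permM fS ?wS ?mem_head // IH // => b bw.
  by apply: wS; rewrite in_cons bw orbT.
exists [set x | f x = 1].
have [s1 s2 s3] := kernel_normal_finite_index f; split=> // _ [x /= fx <-] Hgx.
have := fH _ Hgx; rewrite gmulfM fx mulg1 => fg.
have [p [_ lp pP]] := PP g (mem_head _ _).
have [l hl] : exists l, num g l by apply: numE; apply: pP; rewrite -lp mem_last.
have ln : l < n by apply: leq_trans Yn; case: hl.
have := tr g (Ordinal ln) (mem_head _ _) hl; rewrite fg => -[e].
apply: gH; rewrite -[g]mulg1; case: hl => _; rewrite -e => hl.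
by case: k0P => _ /HV; rewrite mul1g invgK => /(HM hl); rewrite mulgVK mulg1.
Qed.
End Burns.

(** * Quasiconvex subgroups of free products *)

(** Every vertex of a geodesic from [1] to [h] is within [eta] of an element of
    [H]; consecutive choices differ by an element of [H] in the ball of radius
    [eta + 1 + eta], and this ball is finite. *)
Lemma quasiconvex_finitely_generated (G : groupType) (A : seq G) (H : set G) :
  symmetric_generating A -> is_subgroup H -> quasiconvex_wrt A H ->
  exists2 S : seq G, (forall s, s \in S -> H s) &
    forall h, H h -> exists2 w, {subset w <= S} & h = \prod_(a <- w) a.
Proof.
move=> [Asym Agen] [H1 HM HV] [eta qc].
have [B BP] := ball_finite A (eta + 1 + eta).
pose S := [seq b <- B | `[< H b >]].
have inS g k : H g -> H k -> word_dist_le A (eta + 1 + eta) g k ->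
  g^-1 * k \in S.
  move=> Hg Hk /wd_one d; rewrite mem_filter BP // andbT.
  by apply/asboolP/HM => //; apply: HV.
exists S => [s|h Hh]; first by rewrite mem_filter => /andP[/asboolP].
have [p gp] := geodesic_exists Agen 1 h.
have near y : y \in 1 :: p -> exists2 k, H k & word_dist_le A eta y k.
  exact: qc gp y.
suff /(_ 1 1 p) : forall x k q, path (cayley A) x q -> H (last x q) -> H k ->
    word_dist_le A eta k x -> {subset q <= 1 :: p} ->
    exists2 w, {subset w <= S} & k^-1 * last x q = \prod_(a <- w) a.
  have [[pp lp] _] := gp; rewrite lp invg1 mul1g.
  apply=> //; first exact: wd_refl.
  by move=> y yp; rewrite in_cons yp orbT.
move=> x k q; elim: q x k => [|a q IH] x k /=.
  move=> _ Hx Hk kx _; exists [:: k^-1 * x]; last by rewrite big_seq1.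
  by move=> y; rewrite inE => /eqP->; apply: inS => //; apply: wd_leq kx; lia.
move=> /andP[e pq] Hl Hk kx sub.
have [k' Hk' ak'] := near a (sub a (mem_head _ _)).
have [|w wS ew] := IH a k' pq Hl Hk' (wd_sym Asym ak').
  by move=> y yq; apply: sub; rewrite in_cons yq orbT.
exists (k^-1 * k' :: w); last by rewrite big_cons -ew mulgA mulgK.
move=> y; rewrite in_cons => /orP[/eqP->|/wS //]; apply: inS => //.
by apply: wd_trans (wd_trans kx _) ak'; apply: wd_edge.
Qed.

Section StabilizerQuasiconvexity.
Variables (G1 G2 G : groupType).
Variables (i1 : {multiplicative G1 -> G}) (i2 : {multiplicative G2 -> G}).
Hypothesis U : is_free_product i1 i2.
Variable pi : G -> G1.
Hypothesis piP : is_projection i1 i2 pi.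
Variables (A : seq G) (A1 : seq G1).
Hypothesis A_gen : symmetric_generating A.
Hypothesis A1_gen : symmetric_generating A1.
Local Notation wd := (word_dist_le A).
Local Notation wd1 := (word_dist_le A1).
Let Asym := A_gen.1.
Let Agen := A_gen.2.
Let A1sym := A1_gen.1.
Let A1gen := A1_gen.2.

(** Write [s] as a product of syllables: if [pi] changes along [w s], it first
    does so after some prefix [q] of [s] for which [w q] is in the factor, and
    until then [pi] keeps the value [pi w]. The list [F] consists of the
    prefixes. *)
Lemma proj_mul_fiber s : exists F : seq G, forall w,
  pi (w * s) = pi w \/ exists2 q, q \in F & w * q = i1 (pi w).
Proof.
case: (piP) => _ _ piC pi2.
elim/(free_product_ind U): s => [|t a [F FP]|t b [F FP]].
- by exists [::] => w; left; rewrite mulg1.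
- exists (t :: F) => w; rewrite mulgA.
  have [tE|[q qF e]] := FP w; last first.
    by right; exists q; rewrite // in_cons qF orbT.
  have [wt|nwt] := boolP (in_factor i1 pi (w * t)).
    by right; exists t; rewrite ?mem_head // -tE; apply/eqP.
  by left; rewrite piC // => /(in_factorP piP) wt; rewrite wt in nwt.
- by exists F => w; rewrite mulgA pi2.
Qed.

(** With [q] as in [proj_mul_fiber], [w = i1 (pi w) * q^-1] is at bounded
    distance from its projection, and [pi (w * s) = pi w * pi (q^-1 * s)]. *)
Lemma proj_step (S : seq G) : exists M, forall w s, s \in S ->
  pi (w * s) = pi w \/ wd M w (i1 (pi w)) /\ wd1 M (pi w) (pi (w * s)).
Proof.
elim: S => [|s S [M MP]]; first by exists 0%N.
have [F FP] := proj_mul_fiber s.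
have [M1 M1P] := wd_bound Agen F.
have [M2 M2P] := wd_bound A1gen [seq pi (q^-1 * s) | q <- F].
exists (M + M1 + M2)%N => w t.
rewrite in_cons => /orP[/eqP->|/(MP w)[|[w1 w2]]]; last first.
- by right; split; [apply: wd_leq w1 | apply: wd_leq w2]; lia.
- by left.
have [|[q qF e]] := FP w; first by left.
right; split.
  apply/wd_one; rewrite -e mulKg; apply: wd_leq (M1P q qF); lia.
have -> : pi (w * s) = pi w * pi (q^-1 * s).
  by case: (piP) => piM _ _ _; rewrite -piM -e mulgA mulgK.
apply/wd_one; rewrite mulKg.
apply: wd_leq (M2P _ (map_f _ qF)); lia.
Qed.

Lemma factor_lipschitz :
  exists L, forall m g h, wd1 m g h -> wd (L * m) (i1 g) (i1 h).
Proof.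
have [L LP] := wd_bound Agen (map i1 A1); exists L => m g h [p [pp lp] pm].
have : wd (L * size p) (i1 g) (i1 h); last first.
  by apply: wd_leq; rewrite leq_mul2l pm orbT.
elim: p g pp lp {pm} => [|a p IH] g /=; first by move=> _ ->; apply: wd_refl.
move=> /andP[e pp] lp; rewrite mulnS; apply: wd_trans (IH _ pp lp).
apply/wd_one; rewrite -mulfV -gmulfM; apply: LP; exact: map_f.
Qed.

(** Call an index near if its vertex is within [M0] of its projection. By
    [proj_step] the projection is constant on a run of indices that are not
    near, so the near vertices on both sides of the run have nearby projections
    and are close to each other; as the path is geodesic, the run is short. *)
Lemma geodesic_near_projection C0 : exists R, forall x y p, geodesic A x y p ->
  wd C0 x (i1 (pi x)) -> wd C0 y (i1 (pi y)) ->
  forall j, j <= size p ->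
  let w := nth x (x :: p) in wd R (w j) (i1 (pi (w j))).
Proof.
have [M MP] := proj_step A; have [L LP] := factor_lipschitz.
pose M0 := (M + C0)%N; pose E := (M0 + L * M + M0)%N.
exists (E + (M0 + L * M))%N => x y p gp x0 y0 j jp w.
have w0 : w 0%N = x by [].
have wN : w (size p) = y by rewrite /w -last_nth; case: gp => -[].
pose near m := `[< wd M0 (w m) (i1 (pi (w m))) >].
have near0 : near 0%N.
  by apply/asboolP; rewrite w0; apply: wd_leq x0; rewrite leq_addl.
have nearN : near (size p).
  by apply/asboolP; rewrite wN; apply: wd_leq y0; rewrite leq_addl.
have wS m : m < size p -> (w m)^-1 * w m.+1 \in A.
  move=> mp; have [[/pathP pp _] _] := gp.
  by have := pp x m mp; rewrite /cayley /=.
have stepM m : m < size p -> pi (w m.+1) = pi (w m) \/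
    wd M (w m) (i1 (pi (w m))) /\ wd1 M (pi (w m)) (pi (w m.+1)).
  by move=> mp; have := MP (w m) _ (wS m mp); rewrite mulVKg.
have step m : m < size p -> ~~ near m -> pi (w m.+1) = pi (w m).
  move=> mp /asboolP nm; have [//|[wm _]] := stepM m mp.
  by case: nm; apply: wd_leq wm; rewrite leq_addr.
have [/asboolP jn|jn] := boolP (near j).
  by apply: wd_leq jn; rewrite /E; lia.
have exk : exists k, (k <= j) && near k by exists 0%N.
have exl : exists l, (j <= l) && near l by exists (size p); rewrite jp.
(* [k] and [l] are the near indices next to [j] *)
case: (@ex_maxnP _ j exk) => [k /andP[]//|k /andP[kj kn] kmax].
case: (ex_minnP exl) => l /andP[jl ln] lmin.
have lp : l <= size p by apply: lmin; rewrite jp.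
have {}kj : k < j by rewrite ltn_neqAle kj andbT; apply: contraNneq jn => <-.
have up d : j + d <= l -> pi (w (j + d)) = pi (w j).
  elim: d => [|d IH]; first by rewrite addn0.
  move=> le; rewrite addnS step ?IH //; try lia.
  apply/negP => nd; have := lmin (j + d)%N.
  by rewrite nd leq_addr => /(_ isT); lia.
have down d : k + d < j -> pi (w (j - d)) = pi (w j).
  elim: d => [|d IH]; first by rewrite subn0.
  move=> le; rewrite -IH; last lia.
  have -> : j - d = (j - d.+1).+1 by lia.
  rewrite step //; first lia.
  apply/negP => nd; have := kmax (j - d.+1)%N.
  by rewrite nd leq_subr => /(_ isT); lia.
have wk : wd (M0 + L * M) (w k) (i1 (pi (w j))).
  apply: wd_trans (asboolW kn) _; apply: LP.
  have -> : pi (w j) = pi (w k.+1).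
    by rewrite -(down (j - k.+1)%N); [congr (pi (w _)); lia | lia].
  by have [->|[]] := stepM k (leq_trans kj jp) => //; apply: wd_refl.
have wl : wd M0 (w l) (i1 (pi (w j))).
  have -> : pi (w j) = pi (w l).
    by rewrite -(up (l - j)%N); [congr (pi (w _)); lia | lia].
  exact: asboolW ln.
have [_ /(_ _ (wd_trans wk (wd_sym Asym wl))) lk] :=
  geodesic_nth (i := k) (j := l) gp ltac:(lia).
have [jk _] := geodesic_nth (i := k) (j := j) gp ltac:(lia).
by apply: wd_leq (wd_trans (wd_sym Asym jk) wk); rewrite /E; lia.
Qed.

Variable H : set G.
Hypothesis Hsub : is_subgroup H.

(** Here [x * i1 g] is in [H b] for some [b] in the finite ball of radius [r].
    For each such [b] fix a solution [g0]; then [g * g0^-1] stabilizes [H x]. *)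
Lemma near_coset_stabilizer x r :
  exists M, forall g h, H h -> wd r (x * i1 g) h ->
  exists2 k, coset_stabilizer H i1 x k & wd1 M g k.
Proof.
case: Hsub => H1 HM HV.
have [B BP] := ball_finite A r.
suff [M MP] : exists M, forall b, b \in B -> forall g, H (x * i1 g * b^-1) ->
    exists2 k, coset_stabilizer H i1 x k & wd1 M g k.
  exists M => g h Hh /(wd_sym Asym) /wd_one /BP bB.
  by apply: (MP _ bB); rewrite invgM invgK mulgA mulgV mul1g.
elim: B {BP} => [|b B [M MP]]; first by exists 0%N.
have [[g0 Hg0]|ng] := pselect (exists g, H (x * i1 g * b^-1)).
  have [M' M'P] := wd_exists A1gen 1 g0^-1.
  exists (M + M')%N => b'.
  rewrite in_cons => /orP[/eqP->|/MP {}MP] g Hg; last first.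
    have [k Kk gk] := MP g Hg; exists k => //.
    by apply: wd_leq gk; rewrite leq_addr.
  exists (g * g0^-1).
    have := HM _ _ Hg (HV _ Hg0); rewrite !invgM invgK !mulgA mulgVK.
    by rewrite /coset_stabilizer /= gmulfM mulfV !mulgA.
  by apply/wd_one; rewrite mulKg; apply: wd_leq M'P; rewrite leq_addl.
exists M => b'; rewrite in_cons => /orP[/eqP->|/MP //] g Hg.
by case: ng; exists g.
Qed.

Lemma coset_stabilizer_is_subgroup x : is_subgroup (coset_stabilizer H i1 x).
Proof.
case: Hsub => H1 HM HV; rewrite /coset_stabilizer; split=> /=.
- by rewrite mulf1 mulg1 mulgV.
- by move=> a b Ha Hb; have := HM _ _ Ha Hb; rewrite !mulgA mulgVK gmulfM mulgA.
- by move=> a Ha; have := HV _ Ha; rewrite !invgM invgK mulfV mulgA.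
Qed.

(** For [u] and [v] in the stabilizer [K], a geodesic of [G] from [u x^-1] to
    [v x^-1] is near [x^-1 H]. Its projection is a quasigeodesic of [G1] from
    [u c] to [v c], where [c = pi x^-1], and its points are near [K] by
    [near_coset_stabilizer]. Geodesics of [G1] from [u] to [v] are close to this
    quasigeodesic. *)
Lemma coset_stabilizer_quasiconvex delta x : slim_triangles A1 delta ->
  quasiconvex_wrt A H -> quasiconvex_wrt A1 (coset_stabilizer H i1 x).
Proof.
move=> slim [eta qc]; case: (piP) => piM _ _ _.
pose c := pi x^-1.
have [C1 C1P] := wd_exists Agen x^-1 (i1 c).
have [C2 C2P] := wd_exists A1gen 1 c.
have [R0 R0P] := geodesic_near_projection C1.
have [M MP] := proj_step A; have [L LP] := factor_lipschitz.
have [R RP] := geodesic_near_quasigeodesic A1_gen slim M L (R0 + R0).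
have [M' M'P] := near_coset_stabilizer x (R0 + eta).
exists (2 * delta + (C2 + R) + M')%N => u v p Ku Kv gp y yp.
have [q gq] := geodesic_exists Agen (i1 u * x^-1) (i1 v * x^-1).
pose w := nth (i1 u * x^-1) (i1 u * x^-1 :: q).
have w0 : w 0%N = i1 u * x^-1 by [].
have wN : w (size q) = i1 v * x^-1 by rewrite /w -last_nth; case: gq => -[].
have endC g : wd C1 (i1 g * x^-1) (i1 (pi (i1 g * x^-1))).
  by rewrite piM gmulfM; apply/wd_mul.
have wR j : j <= size q -> wd R0 (w j) (i1 (pi (w j))).
  by move=> jq; apply: (R0P _ _ _ gq).
have nearK j : j <= size q ->
    exists2 k, coset_stabilizer H i1 x k & wd1 M' (pi (w j)) k.
  move=> jq; have := geodesic_mul x gq; rewrite !mulgA => gxq.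
  have [|h Hh xh] := qc _ _ _ Ku Kv gxq (x * w j).
    by rewrite -[x * i1 u * _]mulgA -[_ :: _]/(map _ (_ :: _)) map_f // mem_nth.
  apply: (M'P _ h) => //.
  by apply: wd_trans (wd_sym Asym _) xh; apply/wd_mul; apply: wR.
have qg : quasigeodesic A1 M L (R0 + R0) (size q) (fun j => pi (w j)).
  split=> [j jq|i j m ijq d].
    have [[/pathP pp _] _] := gq.
    have := MP (w j) ((w j)^-1 * w j.+1) (pp _ j jq); rewrite mulVKg.
    by case=> [->|[_ //]]; apply: wd_refl.
  have [_ /(_ (R0 + (L * m + R0))%N)] := geodesic_nth gq ijq.
  rewrite -/w => le.
  have : j - i <= R0 + (L * m + R0); last lia.
  apply: le; apply: wd_trans (wR i _) (wd_trans (LP _ _ _ d) _); first lia.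
  by apply: wd_sym => //; apply: wR; lia.
have ends g : pi (i1 g * x^-1) = g * c by rewrite piM.
have endc g : wd1 C2 g (g * c) by apply/wd_one; rewrite mulKg.
have yb := geodesic_between gp yp.
have [z zP yz] :=
  between_quadrilateral A1_gen slim (pi (w 0%N)) (pi (w (size q))) yb.
have [j jq zj] : exists2 j, j <= size q & wd1 (C2 + R) z (pi (w j)).
  case: zP => [zb|/(RP _ _ qg) [j jq zj]|zb].
  - exists 0%N => //; rewrite w0 ends in zb *.
    have [_ zc] := between_wd zb (endc u).
    by apply: wd_leq zc; rewrite leq_addr.
  - by exists j => //; apply: wd_leq zj; rewrite leq_addl.
  - exists (size q) => //; rewrite wN ends in zb *.
    have [zc _] := between_wd zb (wd_sym A1sym (endc v)).
    by apply: wd_leq (wd_sym A1sym zc); rewrite leq_addr.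
have [k Kk jk] := nearK j jq.
by exists k => //; apply: wd_trans (wd_trans yz zj) jk.
Qed.
End StabilizerQuasiconvexity.

Theorem theorem4 (G1 G2 G : groupType)
    (i1 : {multiplicative G1 -> G}) (i2 : {multiplicative G2 -> G}) :
  hyperbolic_group G1 -> GFERF G1 ->
  hyperbolic_group G2 -> GFERF G2 ->
  is_free_product i1 i2 ->
  hyperbolic_group G /\ GFERF G.
Proof.
move=> h1 c1 h2 c2 U; split; first exact: free_product_hyperbolic U h1 h2.
move=> H Hsub [A A_gen qc].
have U' := free_product_sym U.
have [pi1 pi1P] := projection_exists U.
have [pi2 pi2P] := projection_exists U'.
have [A1 [A1_gen [d1 slim1]]] := h1; have [A2 [A2_gen [d2 slim2]]] := h2.
have [S SH Sgen] := quasiconvex_finitely_generated A_gen Hsub qc.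
apply: (closed_of_stabilizers_closed Hsub U SH Sgen) => x.
  apply: c1; first exact: coset_stabilizer_is_subgroup.
  by exists A1 => //; apply: (coset_stabilizer_quasiconvex U pi1P) slim1 qc.
apply: c2; first exact: coset_stabilizer_is_subgroup.
by exists A2 => //; apply: (coset_stabilizer_quasiconvex U' pi2P) slim2 qc.
Qed.
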